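(* Let $G$ be a simple undirected graph with vertex set $\{1,\dots,n\}$ and let $\mathsf{K}(G)$ be the sparse spectrahedral cone described by $G$. Then $\mathsf{K}(G)$ is a homogeneous convex cone if and only if $G$ is a homogeneous chordal graph.
   Context: $\mathbb{S}^n$ is the space of real symmetric $n\times n$ matrices and $\mathbb{S}^n_{++}$ the cone of positive definite matrices in it. For a simple undirected graph $G$ with vertex set $\{1,\dots,n\}$ and edge set $E$, the sparse spectrahedral cone described by $G$ is $\mathsf{K}(G)=\mathbb{S}^n_{++}\cap\mathbb{V}(G)$, where $\mathbb{V}(G)=\{X\in\mathbb{S}^n\mid X_{ij}=0\text{ for all } i\neq j \text{ with } \{i,j\}\notin E\}$. A homogeneous convex cone is a convex cone $\mathsf{K}$ in a finite-dimensional real vector space that is pointed (contains no line), relatively open, and on which the group of linear automorphisms of its linear span mapping $\mathsf{K}$ onto itself acts transitively. A simple undirected graph on $n$ vertices is homogeneous chordal if its vertices can be labelled $1,\dots,n$ so that, with $\hat{E}=\{(i,j)\mid i<j,\ \{i,j\}\text{ is an edge}\}$: (1) $(i,j),(j,k)\in\hat{E}$ implies $(i,k)\in\hat{E}$; and (2) $(i,j),(i,k)\in\hat{E}$ with $j<k$ implies $(j,k)\in\hat{E}$. Equivalently (a known fact), the graph has neither the path $P_4$ on four vertices nor the cycle $C_4$ on four vertices as an induced subgraph. *)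

(* Defs.v *)
From HB Require Import structures.
From mathcomp Require Import all_boot all_order all_fingroup all_algebra.
From mathcomp Require Import all_classical all_reals all_analysis.

Set Implicit Arguments.
Unset Strict Implicit.
Unset Printing Implicit Defensive.

Import Order.TTheory GRing.Theory Num.Theory.
Import numFieldNormedType.Exports.

Local Open Scope classical_set_scope.
Local Open Scope ring_scope.

Section HomogeneousCones.
Variables (R : realType) (V : normedModType R).
Implicit Types (K W : set V) (f : V -> V).

Definition linear_span K : set V :=
  [set x | exists m (c : 'I_m -> R) (v : 'I_m -> V),
     (forall i, K (v i)) /\ x = \sum_(i < m) c i *: v i].

Definition affine_hull K : set V :=
  [set x | exists m (c : 'I_m -> R) (v : 'I_m -> V),
     [/\ forall i, K (v i), \sum_(i < m) c i = 1
       & x = \sum_(i < m) c i *: v i]].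

(* Scaling is by positive reals only, so that open cones, which need not
   contain 0, are allowed. *)
Definition convex_cone K : Prop :=
  convex_set K /\ forall (t : R) (x : V), 0 < t -> K x -> K (t *: x).

Definition contains_line K : Prop :=
  exists x d : V, d != 0 /\ forall t : R, K (x + t *: d).

Definition relatively_open K : Prop :=
  exists2 U : set V, open U & K = U `&` affine_hull K.

(* Linear automorphisms of the subspace W, represented by functions on the
   ambient space of which only the values on W are relevant. *)
Definition linear_automorphism W f : Prop :=
  (forall (a : R) (x y : V), W x -> W y -> f (a *: x + y) = a *: f x + f y) /\
  set_bij W W f.

Definition homogeneous_convex_cone K : Prop :=
  [/\ convex_cone K,
      ~ contains_line K,
      relatively_open K
    & forall x y : V, K x -> K y ->
      exists f, [/\ linear_automorphism (linear_span K) f, f @` K = K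
                  & f x = y]].

End HomogeneousCones.

Section SparseSpectrahedralCones.
Variables (R : realType) (n : nat).

Definition symmetric_matrices : set 'M[R]_n := [set X | X^T = X].

Definition positive_definite : set 'M[R]_n :=
  symmetric_matrices `&`
  [set X | forall u : 'cV[R]_n, u != 0 -> 0 < (u^T *m X *m u) ord0 ord0].

Definition sparse_matrices (e : rel 'I_n) : set 'M[R]_n :=
  symmetric_matrices `&`
  [set X | forall i j : 'I_n, i != j -> ~~ e i j -> X i j = 0].

Definition sparse_spectrahedral_cone (e : rel 'I_n) : set 'M[R]_n :=
  positive_definite `&` sparse_matrices e.

End SparseSpectrahedralCones.

Arguments sparse_spectrahedral_cone R {n} e.

(* A labelling is a permutation s, where s i is the vertex carrying label i. *)
Definition homogeneous_chordal (n : nat) (e : rel 'I_n) : Prop :=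
  exists s : 'S_n,
    let Ehat (i j : 'I_n) := (i < j)%N && e (s i) (s j) in
    (forall i j k : 'I_n, Ehat i j -> Ehat j k -> Ehat i k) /\
    (forall i j k : 'I_n, Ehat i j -> Ehat i k -> (j < k)%N -> Ehat j k).

(* Main.v *)
Require Import Defs.
From mathcomp Require Import all_boot all_order all_fingroup all_algebra.
From mathcomp Require Import all_classical all_reals all_analysis.
From mathcomp Require Import ring lra.

Set Implicit Arguments.
Unset Strict Implicit.
Unset Printing Implicit Defensive.

Import Order.TTheory GRing.Theory Num.Theory.
Import numFieldNormedType.Exports.

Local Open Scope classical_set_scope.
Local Open Scope ring_scope.

(* A labelling as in the definition turns the graph into a forest order. The
   matrices [A] with [A i k = 0] unless [i] is [k] or an ancestor of [k] form an
   incidence algebra whose units act on the cone by [X |-> A X A^T], and the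
   Cholesky algorithm, pivoting in label order, shows that the orbit of [1] is
   the whole cone.

   Conversely, sorting by degree gives a labelling as soon as the closed
   neighbourhoods [N i] and [N j] are nested for every edge [i j]. To a positive
   functional [q] on the cone one attaches the space of functionals [phi] with
   [phi^2 <= 4 q q2] for some positive functional [q2]; automorphisms preserve
   its dimension. For [q = quad^~ u], with [u] supported on an edge [i j], this
   dimension is [#|N i :|: N j|], so that a non-nested edge is recognised by
   having larger dimension than both its end points. This yields, at every point
   [X] of the cone, a convex set around [0] defined in terms of [X] and the
   non-nested edges only, hence equivariantly. The asymmetry of this set about
   [0] is at most [n + 1] for [X = 1], but is unbounded along
   [1 + t (e_i e_j^T + e_j e_i^T)] as [t] tends to [1], for a non-nested edge. *)

(** * Quadratic forms *)

Section QuadraticForms.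
Variables (R : realType) (n : nat).
Implicit Types (X Y : 'M[R]_n) (u v w : 'cV[R]_n).

Definition quad X u : R := (u^T *m X *m u) ord0 ord0.

Lemma quadE X u : quad X u = \sum_i \sum_j u i ord0 * X i j * u j ord0.
Proof.
rewrite /quad -mulmxA mxE; apply: eq_bigr => i _.
by rewrite !mxE mulr_sumr; apply: eq_bigr => j _; rewrite mulrA.
Qed.

Lemma quadD X Y u : quad (X + Y) u = quad X u + quad Y u.
Proof. by rewrite /quad mulmxDr mulmxDl mxE. Qed.

Lemma quadZ a X u : quad (a *: X) u = a * quad X u.
Proof. by rewrite /quad -scalemxAr -scalemxAl mxE. Qed.

Lemma quadN X u : quad (- X) u = - quad X u.
Proof. by rewrite -scaleN1r quadZ mulN1r. Qed.

Lemma quad_congr A X u : quad (A *m X *m A^T) u = quad X (A^T *m u).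
Proof. by rewrite /quad trmx_mul trmxK !mulmxA. Qed.

Lemma quad1E u : quad 1%:M u = \sum_i u i ord0 ^+ 2.
Proof. by rewrite /quad mulmx1 mxE; apply: eq_bigr => i _; rewrite mxE. Qed.

Lemma quad1_ge0 u : 0 <= quad 1%:M u.
Proof. by rewrite quad1E sumr_ge0 // => i _; rewrite sqr_ge0. Qed.

Lemma quad1_gt0 u : u != 0 -> 0 < quad 1%:M u.
Proof.
move=> u0; rewrite lt_def quad1_ge0 andbT; apply: contra u0 => /eqP h.
apply/eqP/matrixP => i j; rewrite (ord1 j) !mxE; apply/eqP.
rewrite -sqrf_eq0; move/eqP: h; rewrite quad1E psumr_eq0; last first.
  by move=> k _; exact: sqr_ge0.
by move/allP => /(_ i (mem_index_enum _)).
Qed.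

Lemma quad_rank1 u v : quad (u *m u^T) v = ((u^T *m v) ord0 ord0) ^+ 2.
Proof.
rewrite /quad !mulmxA -mulmxA mxE big_ord1 -{1}[u]trmxK -trmx_mul mxE expr2.
by [].
Qed.

Lemma mul_delta_row (k : 'I_n) (p : nat) (X : 'M[R]_(n, p)) :
  (delta_mx ord0 k : 'rV_n) *m X = row k X.
Proof. exact/esym/rowE. Qed.

Lemma mul_delta_col (k : 'I_n) (p : nat) (X : 'M[R]_(p, n)) :
  X *m (delta_mx k ord0 : 'cV_n) = col k X.
Proof. exact/esym/colE. Qed.

Lemma quad_delta2 X i j (a b : R) : X^T = X ->
  quad X (a *: delta_mx i ord0 + b *: delta_mx j ord0) =
  a ^+ 2 * X i i + b ^+ 2 * X j j + 2 * a * b * X i j.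
Proof.
move=> Xs; have Xji : X j i = X i j by rewrite -[in LHS]Xs mxE.
have e2 : (a *: delta_mx i ord0 + b *: delta_mx j ord0 : 'cV[R]_n)^T =
    a *: delta_mx ord0 i + b *: delta_mx ord0 j.
  by rewrite linearD /= !linearZ /= !trmx_delta.
rewrite /quad e2 !mulmxDl -!scalemxAl.
rewrite !mul_delta_row !mulmxDr -!scalemxAr !mul_delta_col !mxE Xji.
ring.
Qed.

(** Summing [2 |u_i u_j| <= u_i^2 + u_j^2] over all pairs produces the factor [n]. *)
Lemma quad_bound (c : R) X u : (forall i j, `|X i j| <= c) ->
  `|quad X u| <= c * n%:R * quad 1%:M u.
Proof.
move=> Xc; have -> : c * n%:R * quad 1%:M u =
    \sum_i \sum_j (c * ((u i ord0 ^+ 2 + u j ord0 ^+ 2) / 2)).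
  have s2 : \sum_i \sum_(j < n) u i ord0 ^+ 2 = n%:R * quad 1%:M u.
    rewrite quad1E mulr_sumr; apply: eq_bigr => i _.
    by rewrite sumr_const card_ord mulr_natl.
  under eq_bigr => i _ do rewrite -mulr_sumr -mulr_suml big_split /=.
  rewrite -mulr_sumr -mulr_suml big_split /= s2.
  rewrite exchange_big /= s2; lra.
rewrite quadE; apply: (le_trans (ler_norm_sum _ _ _)); apply: ler_sum => i _.
apply: (le_trans (ler_norm_sum _ _ _)); apply: ler_sum => j _.
rewrite !normrM -mulrA mulrCA.
have h : `|u i ord0| * `|u j ord0| <= (u i ord0 ^+ 2 + u j ord0 ^+ 2) / 2.
  rewrite -(real_normK (num_real (u i ord0))) -(real_normK (num_real (u j ord0))).
  have := sqr_ge0 (`|u i ord0| - `|u j ord0|); lra.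
apply: ler_pM => //; apply: mulr_ge0 => //.
Qed.

Lemma le_sum_entries X i j : `|X i j| <= \sum_i \sum_j `|X i j|.
Proof.
rewrite (bigD1 i) //= (bigD1 j) //= -addrA lerDl addr_ge0 ?sumr_ge0 // => k _.
by rewrite sumr_ge0.
Qed.

Definition psd X := X^T = X /\ forall u, 0 <= quad X u.

Lemma pd_psd X : positive_definite X -> psd X.
Proof.
case=> Xs Xp; split=> // u; have [->|u0] := eqVneq u 0; last exact/ltW/Xp.
by rewrite /quad mulmx0 mxE.
Qed.

Lemma pd1 : positive_definite (1%:M : 'M[R]_n).
Proof. by split; [exact: trmx1 | exact: quad1_gt0]. Qed.

Lemma pdD X Y : positive_definite X -> psd Y -> positive_definite (X + Y).
Proof.
case=> Xs Xp [Ys Yp]; split; first by rewrite /symmetric_matrices /= raddfD /= Xs Ys.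
by move=> u u0; rewrite -/(quad _ _) quadD ltr_wpDr // ?Yp //; exact: Xp.
Qed.

Lemma pdZ (a : R) X : 0 < a -> positive_definite X -> positive_definite (a *: X).
Proof.
move=> a0 [Xs Xp]; split; first by rewrite /symmetric_matrices /= linearZ /= Xs.
by move=> u u0; rewrite -/(quad _ _) quadZ mulr_gt0 //; exact: Xp.
Qed.

Lemma psdZ (a : R) X : 0 <= a -> psd X -> psd (a *: X).
Proof.
move=> a0 [Xs Xp]; split=> [|u]; first by rewrite linearZ /= Xs.
by rewrite quadZ mulr_ge0.
Qed.

Lemma psd_congr A X : psd X -> psd (A *m X *m A^T).
Proof.
case=> Xs Xp; split; first by rewrite !trmx_mul trmxK Xs mulmxA.
by move=> u; rewrite quad_congr.
Qed.

Lemma psd_rank1 u : psd (u *m u^T).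
Proof.
by split; [rewrite trmx_mul trmxK | move=> v; rewrite quad_rank1 sqr_ge0].
Qed.

(* [a * n + 1] works for any bound [a] on the entries of [X] *)
Lemma pd_add_scalar X : X^T = X ->
  exists2 c : R, 0 < c & forall d, c <= d -> positive_definite (d *: 1%:M + X).
Proof.
move=> Xs; pose a := \sum_i \sum_j `|X i j|.
have a0 : 0 <= a by rewrite sumr_ge0 // => i _; rewrite sumr_ge0.
have an0 : 0 <= a * n%:R by rewrite mulr_ge0.
exists (a * n%:R + 1) => [|d cd]; first by rewrite ltr_wpDl.
split; first by rewrite /symmetric_matrices /= raddfD /= linearZ /= trmx1 Xs.
move=> u u0; rewrite -/(quad _ _) quadD quadZ.
have := quad_bound u (le_sum_entries X); rewrite -/a ler_norml => /andP[h _].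
have q0 := quad1_gt0 u0.
have : (a * n%:R + 1) * quad 1%:M u <= d * quad 1%:M u by rewrite ler_pM2r.
by rewrite mulrDl mul1r; lra.
Qed.

End QuadraticForms.

Arguments quad {R n} X u.

(** * Passing to the limit in inequalities *)

Lemma ge0_limit (R : realFieldType) (a b : R) :
  (forall d, 0 < d -> 0 <= a + d * b) -> 0 <= a.
Proof.
move=> h; rewrite leNgt; apply/negP => a0.
pose k := `|b| + 1; have k0 : 0 < k by rewrite /k ltr_wpDl.
have := h (- a / (2 * k)) _; rewrite divr_gt0 ?mulr_gt0 ?oppr_gt0 // => /(_ isT).
have e : - a / (2 * k) * b = (- a / 2) * (b / k) by field; lra.
have bk : b / k <= 1 by rewrite ler_pdivrMr // mul1r /k; have := ler_norm b; lra.
rewrite e; have : (- a / 2) * (b / k) <= - a / 2 * 1.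
  by rewrite ler_wpM2l //; lra.
lra.
Qed.

(** Dividing by [t > 0] and letting [t] tend to [0] gives [0 <= a]; replacing [t] by [- t] gives the
    reverse inequality. *)
Lemma quadratic_ge0_lin (R : realFieldType) (a d : R) :
  (forall t, 0 <= t * a + t ^+ 2 * d) -> a = 0.
Proof.
move=> h; have pos x : (forall t, 0 <= t * x + t ^+ 2 * d) -> 0 <= x.
  move=> hx; apply: (@ge0_limit _ _ d) => t t0; have := hx t.
  by rewrite expr2 -mulrA -mulrDr pmulr_rge0.
apply/eqP; rewrite eq_le pos // andbT -oppr_ge0 pos // => t.
by have := h (- t); rewrite sqrrN mulNr -mulrN.
Qed.

(** * Sparse matrices *)

Section SparseMatrices.
Variables (R : realType) (n : nat) (e : rel 'I_n).
Implicit Types (X Y : 'M[R]_n).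
Local Notation V := (@sparse_matrices R n e).
Local Notation K := (sparse_spectrahedral_cone R e).

Lemma sparse_lin (a : R) X Y : V X -> V Y -> V (a *: X + Y).
Proof.
move=> [Xs Xe] [Ys Ye]; split.
  by rewrite /symmetric_matrices /= raddfD /= linearZ /= Xs Ys.
by move=> i j ij nij; rewrite !mxE Xe // Ye // mulr0 addr0.
Qed.

Lemma sparse0 : V 0.
Proof. by split; [exact: trmx0 | move=> i j _ _; rewrite mxE]. Qed.

Lemma sparseD X Y : V X -> V Y -> V (X + Y).
Proof. by move=> VX VY; rewrite -[X]scale1r; exact: sparse_lin. Qed.

Lemma sparseZ (a : R) X : V X -> V (a *: X).
Proof.
by move=> VX; rewrite -[_ *: _]addr0; apply: sparse_lin => //; exact: sparse0.
Qed.

Lemma sparse_sum (I : finType) (F : I -> 'M[R]_n) :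
  (forall i, V (F i)) -> V (\sum_i F i).
Proof.
by move=> h; elim/big_ind: _ => //; [exact: sparse0 | exact: sparseD].
Qed.

Lemma sparse1 : V 1%:M.
Proof.
split; first exact: trmx1.
by move=> i j ij _; rewrite mxE (negbTE ij).
Qed.

Lemma cone_sparse X : K X -> V X. Proof. by case. Qed.

Lemma cone_pd X : K X -> positive_definite X. Proof. by case. Qed.

Lemma cone1 : K 1%:M. Proof. by split; [exact: pd1 | exact: sparse1]. Qed.

Lemma coneD X Y : K X -> V Y -> psd Y -> K (X + Y).
Proof. by move=> [pX VX] VY pY; split; [exact: pdD | exact: sparseD]. Qed.

Lemma coneZ (a : R) X : 0 < a -> K X -> K (a *: X).
Proof. by move=> a0 [pX VX]; split; [exact: pdZ | exact: sparseZ]. Qed.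

Lemma cone_add_scalar X : V X ->
  exists2 c : R, 0 < c & forall d, c <= d -> K (d *: 1%:M + X).
Proof.
move=> VX; have [c c0 h] := pd_add_scalar VX.1; exists c => // d cd.
by split; [exact: h | apply: sparse_lin => //; exact: sparse1].
Qed.

Lemma linear_span_cone : linear_span K = V.
Proof.
apply/seteqP; split=> X.
  move=> [m [c [v [Kv ->]]]]; apply: sparse_sum => i.
  by apply: sparseZ; apply: cone_sparse.
move=> VX; have [c c0 /(_ c (lexx _)) KX] := cone_add_scalar VX.
exists 2%N, (fun i => if i == ord0 then 1 else - c),
  (fun i => if i == ord0 then c *: 1%:M + X else 1%:M).
split=> [i|]; first by case: ifP => // _; exact: cone1.
by rewrite !big_ord_recl big_ord0 /= scale1r scaleNr addr0 addrC addrA addNr add0r.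
Qed.

Lemma affine_hull_cone X : affine_hull K X -> V X.
Proof.
move=> [m [c [v [Kv _ ->]]]]; apply: sparse_sum => i.
by apply: sparseZ; apply: cone_sparse.
Qed.

Lemma convex_cone_sparse : convex_cone K.
Proof.
split; last by move=> t x; exact: coneZ.
move=> X Y l; rewrite !inE => KX KY.
have l0 : 0 <= l%:num by [].
have l1 : l%:num <= 1 by [].
change (K (l%:num *: X + (1 - l%:num) *: Y)).
have [l00|lp] := eqVneq l%:num 0; first by rewrite l00 scale0r add0r subr0 scale1r.
have {}lp : 0 < l%:num by rewrite lt_def lp.
apply: coneD; first exact: coneZ.
  exact/sparseZ/cone_sparse.
have [Ys Yp] := pd_psd (cone_pd KY); split; first by rewrite linearZ /= Ys.
by move=> u; rewrite quadZ mulr_ge0 // subr_ge0.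
Qed.

Lemma cone_no_line : ~ contains_line K.
Proof.
move=> [X [D [D0 h]]]; have Ds : D^T = D.
  have Xs : X^T = X by have := h 0; rewrite scale0r addr0 => -[[]].
  have : (X + D)^T = X + D by have := h 1; rewrite scale1r => -[[]].
  by rewrite raddfD /= Xs => /addrI.
(* Along the line [quad] is affine in [t] and nonnegative, so its slope vanishes. *)
have q0 u : quad D u = 0.
  have hq t : 0 <= quad X u + t * quad D u.
    by have [_] := pd_psd (cone_pd (h t)) => /(_ u); rewrite quadD quadZ.
  have [//|d0] := eqVneq (quad D u) 0.
  have := hq ((- quad X u - 1) / quad D u); rewrite mulfVK //.
  by rewrite addrA subrr add0r oppr_ge0 ler10.
move/eqP: D0; apply; apply/matrixP => i j.
have h2 a b := quad_delta2 i j a b Ds.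
have := h2 1 0; have := h2 0 1; have := h2 1 1; rewrite !q0 !mxE.
lra.
Qed.

End SparseMatrices.

(** * Homogeneous chordal graphs have homogeneous cones *)

Section IncidenceAlgebra.
Variables (R : realType) (n : nat) (e : rel 'I_n) (rk : 'I_n -> nat).
Hypotheses (e_sym : symmetric e) (rk_inj : injective rk).
Implicit Types (A B X Y : 'M[R]_n).
Local Notation V := (@sparse_matrices R n e).
Local Notation K := (sparse_spectrahedral_cone R e).

(** Larger ranks are nearer the root: under the two hypotheses that follow, this is an order in
    which the vertices above a given one form a chain. *)
Definition below (i j : 'I_n) := (i == j) || ((rk i < rk j)%N && e i j).

Hypothesis below_trans : transitive below.
Hypothesis below_chain :
  forall i j k, below i j -> below i k -> below j k || below k j.

Lemma below_edge i j : below i j || below j i = ((i == j) || e i j).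
Proof.
rewrite /below (eq_sym j i) (e_sym j i); have [->|ij] := eqVneq i j => //=.
have := contra_neq (@rk_inj i j) ij.
by case: ltngtP => // _ _; rewrite ?orbF.
Qed.

Definition incidence A := forall i k, ~~ below k i -> A i k = 0.

Lemma incidence_mul A B : incidence A -> incidence B -> incidence (A *m B).
Proof.
move=> hA hB i k nki; rewrite mxE big1 // => l _.
have [li|/hA ->] := boolP (below l i); last by rewrite mul0r.
have [kl|/hB ->] := boolP (below k l); last by rewrite mulr0.
by rewrite (below_trans kl li) in nki.
Qed.

(** A nonzero term of entry [(i, j)] needs [below k i], [below l j] and comparable [k], [l]. The
    lower of [k] and [l] is below both [i] and [j], which are then comparable by [below_chain]. *)
Lemma incidence_sparse A X : incidence A -> V X -> V (A *m X *m A^T).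
Proof.
move=> hA [Xs Xe]; split.
  by rewrite /symmetric_matrices /= !trmx_mul trmxK Xs mulmxA.
move=> i j ij nij; rewrite mxE big1 // => l _; rewrite !mxE.
have [lj|/hA ->] := boolP (below l j); last by rewrite mulr0.
rewrite big1 ?mul0r // => k _.
have [ki|/hA ->] := boolP (below k i); last by rewrite mul0r.
have [kl|] := boolP ((k == l) || e k l); last first.
  by rewrite negb_or => /andP[kl nkl]; rewrite Xe ?mulr0.
exfalso; move: kl; rewrite -below_edge => /orP[kl|lk].
  have := below_chain ki (below_trans kl lj).
  by rewrite below_edge (negbTE ij) (negbTE nij).
have := below_chain lj (below_trans lk ki).
by rewrite orbC below_edge (negbTE ij) (negbTE nij).
Qed.

Definition same_orbit X Y := exists A B,
  [/\ incidence A, incidence B, A *m B = 1%:M & Y = A *m X *m A^T].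

Lemma same_orbit_cone X Y : same_orbit X Y -> K X -> K Y.
Proof.
move=> [A [B [iA iB AB ->]]] [pX VX]; split; last exact: incidence_sparse.
have [Xs Xp] := pX; split; first exact: (psd_congr A (pd_psd pX)).1.
move=> u u0; rewrite -/(quad _ _) quad_congr; apply: Xp; apply: contra u0.
move=> /eqP h; have := congr1 (mulmx B^T) h.
by rewrite mulmxA -trmx_mul AB trmx1 mul1mx mulmx0 => ->.
Qed.

Lemma same_orbit_sym X Y : same_orbit X Y -> same_orbit Y X.
Proof.
move=> [A [B [iA iB AB ->]]]; have BA := mulmx1C AB; exists B, A; split=> //.
by rewrite -!mulmxA -trmx_mul BA trmx1 mulmx1 mulmxA BA mul1mx.
Qed.

Lemma same_orbit_trans Y X Z :
  same_orbit X Y -> same_orbit Y Z -> same_orbit X Z.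
Proof.
move=> [A [B [iA iB AB ->]]] [C [D [iC iD CD ->]]].
exists (C *m A), (B *m D); split; try exact: incidence_mul.
  by rewrite mulmxA -(mulmxA C) AB mulmx1.
by rewrite trmx_mul !mulmxA.
Qed.

Lemma same_orbit_refl X : same_orbit X X.
Proof.
have i1 : incidence 1%:M.
  move=> i k; rewrite /below negb_or eq_sym mxE => /andP[/negbTE -> _] //.
by exists 1%:M, 1%:M; split; rewrite ?trmx1 ?mulmx1 ?mul1mx.
Qed.

(** One Cholesky step: an elementary congruence clears row and column [k], normalises the pivot and
    keeps the earlier rows. *)
Lemma pivot X k : K X ->
  (forall i j, (rk i < rk k)%N -> X i j = (i == j)%:R) ->
  exists2 Y, same_orbit X Y &
    forall i j, (rk i <= rk k)%N -> Y i j = (i == j)%:R.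
Proof.
move=> [pX [Xs Xe]] Xid; have Xsy i j : X i j = X j i by rewrite -[in LHS]Xs mxE.
pose d := X k k.
have d0 : 0 < d.
  have /pX.2 : (1 *: delta_mx k ord0 + 0 *: delta_mx k ord0 : 'cV[R]_n) != 0.
    rewrite scale1r scale0r addr0; apply/eqP => /matrixP /(_ k ord0)/eqP.
    by rewrite !mxE !eqxx oner_eq0.
  rewrite -/(quad _ _) quad_delta2 // -/d; lra.
pose r := Num.sqrt d; have r0 : 0 < r by rewrite sqrtr_gt0.
have rd : r ^+ 2 = d by rewrite sqr_sqrtr // ltW.
pose w : 'cV[R]_n := \col_i (if i == k then r^-1 - 1 else - X i k / d).
pose T (v : 'cV[R]_n) : 'M[R]_n := 1%:M + v *m delta_mx ord0 k.
have TE v i j : T v i j = (i == j)%:R + v i ord0 * (j == k)%:R.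
  by rewrite !mxE big_ord1 !mxE eqxx.
(* Earlier rows are already clear and non-neighbours have zero entries, so the elimination matrix
   lies in the incidence algebra. *)
have w0 i : ~~ below k i -> w i ord0 = 0.
  rewrite mxE /below negb_or negb_and eq_sym => /andP[ik]; rewrite (negbTE ik).
  rewrite -leqNgt => /orP[le_rk|nki].
    rewrite Xid ?(negbTE ik) ?oppr0 ?mul0r // ltn_neqAle le_rk andbT.
    by apply: contra ik => /eqP/rk_inj ->.
  by rewrite Xe ?oppr0 ?mul0r // e_sym.
have iT a : incidence (T (a *: w)).
  move=> i j nji; rewrite TE; move: (nji); rewrite {1}/below negb_or eq_sym.
  move=> /andP[/negbTE -> _]; rewrite add0r; have [jk|_] := eqVneq j k.
    by rewrite mxE w0 ?mulr0 ?mul0r // -jk.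
  by rewrite mulr0.
have eTe (v : 'cV[R]_n) : (delta_mx ord0 k : 'rV[R]_n) *m v = (v k ord0)%:M.
  by rewrite mul_delta_row; apply/matrixP => i j; rewrite !ord1 !mxE eqxx mulr1n.
(* Here [M *m M = w k ord0 *: M] and [1 + w k ord0 = r^-1], so the inverse of [1 + M] is
   [1 - r M]. *)
have AB : T (1 *: w) *m T (- r *: w) = 1%:M.
  rewrite /T scale1r; set M := w *m delta_mx ord0 k.
  have -> : (- r *: w) *m delta_mx ord0 k = - r *: M by rewrite -scalemxAl.
  have MM : M *m M = w k ord0 *: M.
    by rewrite /M -mulmxA [X in w *m X]mulmxA eTe mul_scalar_mx -scalemxAr.
  rewrite mulmxDl mul1mx mulmxDr mulmx1 -scalemxAr MM scalerA -addrA.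
  rewrite -{2}[M]scale1r -!scalerDl mxE eqxx.
  suff -> : - r + (1 + - r * (r^-1 - 1)) = 0 by rewrite scale0r addr0.
  by field; lra.
exists (T (1 *: w) *m X *m (T (1 *: w))^T).
  by exists (T (1 *: w)), (T (- r *: w)).
have YE i j : (T (1 *: w) *m X *m (T (1 *: w))^T) i j =
    X i j + w i ord0 * X k j + (X i k + w i ord0 * d) * w j ord0.
  rewrite scale1r /T linearD /= trmx1 trmx_mul trmx_delta mulmxDr mulmx1 !mulmxA.
  rewrite mul_delta_col !mulmxDl !mul1mx -!mulmxA mul_delta_row.
  by rewrite !mxE !big_ord1 !mxE big_ord1 !mxE.
move=> i j; rewrite leq_eqVlt => /orP[/eqP/rk_inj ->|lt_ik]; rewrite YE.
  have -> : w k ord0 = r^-1 - 1 by rewrite mxE eqxx.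
  have [<-|kj] := eqVneq k j.
    by rewrite [w k ord0]mxE eqxx -/d -rd ?mulr1n; clearbody r; field; lra.
  rewrite [w j ord0]mxE eq_sym (negbTE kj) (Xsy j k) -/d ?mulr0n.
  by clearbody r d; field; rewrite !gt_eqF.
have ik : i != k by apply: contraTneq lt_ik => ->; rewrite ltnn.
have wi : w i ord0 = 0 by rewrite mxE (negbTE ik) Xid // (negbTE ik) oppr0 mul0r.
by rewrite wi !mul0r !addr0 Xid // (Xid _ k) // (negbTE ik) mul0r addr0.
Qed.

Lemma cone_orbit1 X : K X -> same_orbit X 1%:M.
Proof.
move=> KX; have elim m : exists2 Y, same_orbit X Y &
    forall i j, (rk i < m)%N -> Y i j = (i == j)%:R.
  elim: m => [|m [Y XY Yid]]; first by exists X => //; exact: same_orbit_refl.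
  (* Ranks need not be consecutive; a value taken by no vertex requires no pivot. *)
  have [[k rkk]|nk] := pselect (exists k, rk k = m); last first.
    exists Y => // i j; rewrite ltnS leq_eqVlt => /orP[/eqP rki|]; last exact: Yid.
    by case: nk; exists i.
  have [|Z YZ Zid] := pivot (same_orbit_cone XY KX) (k := k).
    by rewrite rkk.
  exists Z; first exact: same_orbit_trans YZ.
  by move=> i j; rewrite ltnS -rkk; exact: Zid.
have [Y XY Yid] := elim (\max_i rk i).+1.
suff <- : Y = 1%:M by [].
by apply/matrixP => i j; rewrite Yid ?mxE // ltnS leq_bigmax.
Qed.

Lemma cone_transitive X Y : K X -> K Y ->
  exists f, [/\ linear_automorphism (linear_span K) f, f @` K = K & f X = Y].
Proof.
move=> KX KY.
have [A [B [iA iB AB ->]]] :=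
  same_orbit_trans (cone_orbit1 KX) (same_orbit_sym (cone_orbit1 KY)).
have BA := mulmx1C AB.
pose f (C Z : 'M[R]_n) : 'M[R]_n := C *m Z *m C^T.
have fK (C D : 'M[R]_n) : C *m D = 1%:M -> cancel (f D) (f C).
  move=> CD Z; rewrite /f -!mulmxA -trmx_mul CD trmx1 mulmx1.
  by rewrite mulmxA CD mul1mx.
have fc (C D : 'M[R]_n) : incidence C -> incidence D -> C *m D = 1%:M ->
    forall Z, K Z -> K (f C Z).
  by move=> iC iD CD Z; apply: same_orbit_cone; exists C, D.
exists (f A); split=> //.
  rewrite linear_span_cone; split.
    by move=> a Z W _ _; rewrite /f mulmxDr mulmxDl -scalemxAr -scalemxAl.
  split.
  - by move=> Z; exact: incidence_sparse.
  - by move=> Z W _ _; exact: (can_inj (fK _ _ BA)).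
  - by move=> Z VZ; exists (f B Z); [exact: incidence_sparse | exact: fK].
apply/seteqP; split=> [_ [Z KZ <-]|Z KZ]; first exact: (fc _ B).
by exists (f B Z); [exact: (fc _ A) | exact: fK].
Qed.

(* Write [X = A A^T] and bound [u = A^-T (A^T u)] by a multiple of [A^T u]. *)
Lemma cone_coercive X : K X ->
  exists2 c : R, 0 < c & forall u, c * quad 1%:M u <= quad X u.
Proof.
move=> KX; have [A [B [_ _ AB ->]]] := same_orbit_sym (cone_orbit1 KX).
pose a := \sum_i \sum_j `|(B *m B^T) i j|.
have a0 : 0 <= a by rewrite sumr_ge0 // => i _; rewrite sumr_ge0.
have an0 : 0 < a * n%:R + 1 by rewrite ltr_wpDl // mulr_ge0.
exists (a * n%:R + 1)^-1; first by rewrite invr_gt0.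
move=> u; rewrite quad_congr mulrC ler_pdivrMr //.
have -> : u = B^T *m (A^T *m u) by rewrite mulmxA -trmx_mul AB trmx1 mul1mx.
set v := A^T *m u; rewrite -[X in _ <= quad _ (A^T *m X) * _]mul1mx.
have -> : A^T *m (1%:M *m (B^T *m v)) = v.
  by rewrite mul1mx mulmxA -trmx_mul (mulmx1C AB) trmx1 mul1mx.
rewrite -quad_congr mulmx1.
have := quad_bound v (le_sum_entries (B *m B^T)); rewrite -/a ler_norml => /andP[_].
by have := quad1_ge0 v; rewrite mulrDr mulr1 [quad 1%:M v * _]mulrC; lra.
Qed.

Lemma cone_relatively_open : relatively_open K.
Proof.
pose P : set 'M[R]_n := [set X | forall u : 'cV[R]_n, u != 0 -> 0 < quad X u].
exists (interior P); first exact: open_interior.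
apply/seteqP; split=> X; last first.
  move=> [/interior_subset PX /affine_hull_cone VX]; split=> //; split=> //.
  exact: VX.1.
move=> KX; split; last first.
  by exists 1%N, (fun=> 1), (fun=> X); split=> //; rewrite big_ord1 // scale1r.
have [c c0 cX] := cone_coercive KX.
(* Within this radius the form changes by at most [c * n / (n + 1)] times [quad 1%:M u], strictly
   less than the coercivity bound. *)
apply/nbhs_ballP; exists (c / (n%:R + 1)) => /=; first by rewrite divr_gt0 // ltr_wpDl.
move=> Y [_ XY] u u0; have q0 := quad1_gt0 u0.
have hb : forall i j, `|(X - Y) i j| <= c / (n%:R + 1).
  move=> i j; rewrite !mxE; exact/ltW/XY.
have := quad_bound u hb; rewrite ler_norml => /andP[_].
rewrite quadD quadN => h; have := cX u.
have : c / (n%:R + 1) * n%:R * quad 1%:M u < c * quad 1%:M u.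
  rewrite ltr_pM2r // mulrAC ltr_pdivrMr ?ltr_wpDl // ltr_pM2l //; lra.
lra.
Qed.

Lemma cone_homogeneous : homogeneous_convex_cone K.
Proof.
split; [exact: convex_cone_sparse | exact: cone_no_line |
        exact: cone_relatively_open | exact: cone_transitive].
Qed.

End IncidenceAlgebra.

(** The rank of a vertex is its label; the first condition on labels makes [below] transitive, the
    second yields the chains. *)
Lemma chordal_cone_homogeneous (R : realType) (n : nat) (e : rel 'I_n) :
  symmetric e -> homogeneous_chordal e ->
  homogeneous_convex_cone (sparse_spectrahedral_cone R e).
Proof.
move=> e_sym [s [h1 h2]]; pose rk i : nat := (s^-1)%g i.
have rk_inj : injective rk by move=> i j /val_inj/perm_inj.
have E i j : (rk i < rk j)%N && e i j =
    ((s^-1)%g i < (s^-1)%g j)%N && e (s ((s^-1)%g i)) (s ((s^-1)%g j)).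
  by rewrite !permKV.
apply: (cone_homogeneous R e_sym rk_inj).
  move=> j i k /orP[/eqP -> //|ij] /orP[/eqP <-|jk]; rewrite /below ?ij ?orbT //.
  by rewrite E (h1 _ ((s^-1)%g j)) ?orbT // -E.
move=> i j k /orP[/eqP -> ->//|ij] /orP[/eqP <-|ik]; first by rewrite /below ij !orbT.
rewrite E in ij; rewrite E in ik; rewrite /below.
have [jk|jk|/rk_inj ->] := ltngtP (rk j) (rk k); last by rewrite eqxx.
- by have := h2 _ _ _ ij ik jk; rewrite -E => /andP[_ ->]; rewrite orbT.
- by have := h2 _ _ _ ik ij jk; rewrite -E => /andP[_ ->]; rewrite !orbT.
Qed.

(** * Nested neighbourhoods *)

Section NestedNeighbourhoods.
Variables (n : nat) (e : rel 'I_n).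
Hypotheses (e_sym : symmetric e).

Definition closed_nbhd (i : 'I_n) : {set 'I_n} := [set j | (j == i) || e i j].

Lemma nested_homogeneous_chordal :
  (forall i j, e i j -> (closed_nbhd i \subset closed_nbhd j) ||
                        (closed_nbhd j \subset closed_nbhd i)) ->
  homogeneous_chordal e.
Proof.
move=> nested; pose deg i := #|closed_nbhd i|.
pose r := sort (relpre deg leq) (enum 'I_n).
have size_r : size r = n by rewrite size_sort size_enum_ord.
have f_inj : injective (fun i : 'I_n => nth i r i).
  move=> i j; rewrite (set_nth_default i) ?size_r // => /eqP.
  rewrite nth_uniq ?size_r ?sort_uniq ?enum_uniq // => /eqP; exact: val_inj.
(* Vertices are sorted by the size of their closed neighbourhoods, so the reverse inclusion would
   force equality. *)
have mono (i j : 'I_n) : (i < j)%N -> e (perm f_inj i) (perm f_inj j) ->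
    closed_nbhd (perm f_inj i) \subset closed_nbhd (perm f_inj j).
  move=> ij /nested/orP[//|ji].
  suff : closed_nbhd (perm f_inj j) == closed_nbhd (perm f_inj i) by move/eqP->.
  rewrite eqEcard ji /= !permE (set_nth_default i j) ?size_r //.
  have tr : transitive (relpre deg leq) by move=> x y z; exact: leq_trans.
  have rf : reflexive (relpre deg leq) by move=> x /=.
  have so : sorted (relpre deg leq) r by apply: sort_sorted => x y; exact: leq_total.
  by apply: (sorted_leq_nth tr rf i so); rewrite ?inE ?size_r // ltnW.
exists (perm f_inj) => /=; split=> i j k /andP[ij eij] /andP[jk ejk].
  rewrite (ltn_trans ij jk) /=.
  have /fintype.subsetP/(_ (perm f_inj i)) := mono _ _ jk ejk.
  rewrite !inE e_sym eij orbT => /(_ isT); rewrite e_sym => /orP[|//].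
  by rewrite (inj_eq perm_inj) => /eqP ik; move: (ltn_trans ij jk); rewrite ik ltnn.
move=> lt_jk; rewrite lt_jk /=.
have /fintype.subsetP/(_ (perm f_inj k)) := mono _ _ ij eij.
rewrite !inE ejk orbT => /(_ isT) /orP[|//].
by rewrite (inj_eq perm_inj) => /eqP kj; rewrite kj ltnn in lt_jk.
Qed.

End NestedNeighbourhoods.

(** * Positive functionals on the cone *)

Lemma mxtrace_mulE (R : realType) (n : nat) (X Y : 'M[R]_n) :
  \tr (X *m Y) = \sum_i \sum_j X i j * Y j i.
Proof. by apply: eq_bigr => i _; rewrite mxE. Qed.

Lemma mxtrace_delta (R : realType) (n : nat) (i k : 'I_n) (M : 'M[R]_n) :
  \tr (delta_mx i k *m M) = M k i.
Proof.
rewrite mxtrace_mulE (bigD1 i) //= [X in _ + X]big1 => [|j /negbTE ji]; last first.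
  by rewrite big1 // => l _; rewrite mxE ji mul0r.
rewrite (bigD1 k) //= big1 => [|l /negbTE lk]; last by rewrite mxE lk andbF mul0r.
by rewrite !mxE !eqxx mul1r !addr0.
Qed.

Definition sym_delta (R : realType) (n : nat) (i j : 'I_n) : 'M[R]_n :=
  delta_mx i j + delta_mx j i.

Lemma tr_sym_delta (R : realType) (n : nat) (i j : 'I_n) :
  (sym_delta R i j)^T = sym_delta R i j.
Proof. by rewrite /sym_delta linearD /= !trmx_delta addrC. Qed.

Lemma sparse_sym_delta (R : realType) (n : nat) (e : rel 'I_n) (i j : 'I_n) :
  symmetric e -> (i == j) || e i j -> sparse_matrices e (sym_delta R i j).
Proof.
move=> e_sym ij; split; first exact: tr_sym_delta.
move=> k l kl nkl; rewrite !mxE.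
have h x y : (x == i) && (y == j) -> (x == y) || e x y.
  by move=> /andP[/eqP -> /eqP ->].
have f x y : x != y -> ~~ e x y -> (x == i) && (y == j) = false.
  move=> xy nxy; apply/negbTE/negP => /h; by rewrite (negbTE xy) (negbTE nxy).
by rewrite f // andbC f ?addr0 // 1?eq_sym // e_sym.
Qed.

Lemma mxtrace_sym_delta (R : realType) (n : nat) (i j : 'I_n) (M : 'M[R]_n) :
  M^T = M -> \tr (sym_delta R i j *m M) = 2 * M i j.
Proof.
move=> Ms; rewrite mulmxDl linearD /= !mxtrace_delta.
by have -> : M j i = M i j; [rewrite -[in LHS]Ms mxE | ring].
Qed.

Lemma mxtrace_psd_pos (R : realType) (n : nat) (Y : 'M[R]_n) :
  (forall X, positive_definite X -> 0 <= \tr (Y *m X)) ->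
  forall X, psd X -> 0 <= \tr (Y *m X).
Proof.
move=> h X pX; apply: (@ge0_limit _ _ (\tr (Y *m 1%:M))) => d d0.
have := h _ (pdD (pdZ d0 (pd1 _ _)) pX).
by rewrite mulmxDr linearD /= -scalemxAr linearZ /= addrC.
Qed.

(* M. Riesz extension, adding one edge at a time. *)
Lemma dual_completion (R : realType) (n : nat) (e : rel 'I_n) (Y : 'M[R]_n) :
  symmetric e -> Y^T = Y ->
  (forall X, sparse_spectrahedral_cone R e X -> 0 <= \tr (Y *m X)) ->
  exists Z : 'M[R]_n, [/\ Z^T = Z,
    forall X, sparse_matrices e X -> \tr (Z *m X) = \tr (Y *m X)
    & forall X, psd X -> 0 <= \tr (Z *m X)].
Proof.
pose nonedges (e : rel 'I_n) : {set 'I_n * 'I_n} :=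
  [set p | (p.1 != p.2) && ~~ e p.1 p.2]%SET.
have [k] := ubnP #|nonedges e|; elim: k e Y => // k IH e Y ek e_sym Ys Ypos.
have [e0|[[a b]]] := set_0Vmem (nonedges e).
  exists Y; split=> //; apply: mxtrace_psd_pos => X pX; apply: Ypos; split=> //.
  split; first exact: pX.1.
  by move=> i j ij nij; have := finset.in_set0 (i, j); rewrite -e0 inE /= ij nij.
rewrite inE /= => /andP[ab nab].
pose e' i j := [|| e i j, (i == a) && (j == b) | (i == b) && (j == a)].
have e'_sym : symmetric e'.
  move=> i j; rewrite /e' (e_sym i j); congr (_ || _).
  by rewrite orbC; congr (_ || _); rewrite andbC.
pose F := sym_delta R a b.
have FF : \tr (F *m F) = 2.
  rewrite mxtrace_sym_delta ?tr_sym_delta // !mxE !eqxx (negbTE ab) /= addr0 mulr1 //.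
have FX X : sparse_matrices e X -> \tr (F *m X) = 0.
  by move=> [Xs Xe]; rewrite mxtrace_sym_delta // Xe // mulr0.
(* A value assigned to [F] must be at least every element of [E], by positivity at [X + F], and at
   most [\tr (Y *m X)] whenever [X - F] is positive definite. *)
pose E := [set r | exists2 X, sparse_matrices e X /\ positive_definite (X + F) &
   r = - \tr (Y *m X)].
have E_ub X : sparse_matrices e X -> positive_definite (X - F) ->
    ubound E (\tr (Y *m X)).
  move=> VX pX _ [W [VW pW] ->]; rewrite -subr_ge0 opprK -linearD /= -mulmxDr.
  apply: Ypos; split; last exact: sparseD.
  have -> : X + W = (X - F) + (W + F) by rewrite addrACA addNr addr0.
  exact: (pdD pX (pd_psd pW)).
have [d1 d10 /(_ d1 (lexx _)) pF] := pd_add_scalar (tr_sym_delta R a b).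
have [d2 d20 /(_ d2 (lexx _)) pNF] : exists2 c : R, 0 < c &
    forall d, c <= d -> positive_definite (d *: 1%:M - F).
  by apply: pd_add_scalar; rewrite linearN /= tr_sym_delta.
have V1 (d : R) : sparse_matrices e (d *: 1%:M) by exact/sparseZ/sparse1.
have E0 : E !=set0 by eexists; exists (d1 *: 1%:M).
have supE : has_sup E by split=> //; eexists; exact: (E_ub _ (V1 d2)).
(* As [\tr (F *m F) = 2], adding [s *: F] makes the value at [F] equal to [c]; values on sparse
   matrices, orthogonal to [F], do not change. *)
pose c := sup E; pose s := (c - \tr (Y *m F)) / 2.
pose Y' := Y + s *: F.
have Y'E X t : sparse_matrices e X -> \tr (Y' *m (X + t *: F)) = \tr (Y *m X) + t * c.
  have trD (M : 'M[R]_n) : \tr (M *m (X + t *: F)) = \tr (M *m X) + t * \tr (M *m F).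
    by rewrite mulmxDr linearD /= -scalemxAr linearZ.
  move=> VX; rewrite mulmxDl linearD /= -scalemxAl linearZ /= !trD (FX _ VX) FF /s.
  by field.
have [|||Z [Zs ZY Zpos]] := IH e' Y' _ e'_sym.
- rewrite -ltnS (leq_trans _ ek) // ltnS; apply: proper_card; apply/properP.
  split; last by exists (a, b); rewrite inE /= ?ab ?nab // /e' !eqxx !orbT andbF.
  apply/fintype.subsetP => p; rewrite !inE => /andP[-> /=]; apply: contra.
  by rewrite /e' => ->.
- by rewrite linearD /= linearZ /= Ys tr_sym_delta.
- move=> X [pX [Xs Xe]]; pose t := X a b; pose W := X - t *: F.
  have XE : X = W + t *: F by rewrite /W subrK.
  have VW : sparse_matrices e W.
    split.
      by rewrite /symmetric_matrices /= linearD linearN linearZ /= tr_sym_delta Xs.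
    move=> i j ij nij; rewrite !mxE; have [e'ij|ne'] := boolP (e' i j); last first.
      have := ne'; rewrite /e' !negb_or => /and3P[_ /negbTE -> /negbTE].
      by rewrite andbC => ->; rewrite Xe // addr0 mulr0 subr0.
    move: e'ij; rewrite /e' (negbTE nij) /= => /orP[] /andP[/eqP -> /eqP ->].
      by rewrite !eqxx (negbTE ab) addr0 mulr1 subrr.
    rewrite !eqxx eq_sym (negbTE ab) add0r mulr1 /t.
    by rewrite -[in X in X - _]Xs mxE subrr.
  (* After rescaling by the absolute value of [t], the upper bound on [c] settles [t < 0] and the
     lower bound settles [t > 0]. *)
  clearbody W; rewrite XE Y'E //; have [t0|t0|t0] := ltgtP t 0.
  + have p : 0 < - t by rewrite oppr_gt0.
    have : c <= \tr (Y *m ((- t)^-1 *: W)).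
      apply: ge_sup => //; apply: E_ub; first exact: sparseZ.
      have -> : (- t)^-1 *: W - F = (- t)^-1 *: X.
        by rewrite XE scalerDr scalerA invrN mulNr mulVf ?lt_eqF // scaleN1r.
      by apply: pdZ => //; rewrite invr_gt0.
    rewrite -scalemxAr linearZ /= mulrC ler_pdivlMr //; lra.
  + have : - \tr (Y *m (t^-1 *: W)) <= c.
      apply: sup_upper_bound => //; exists (t^-1 *: W) => //.
      split; first exact: sparseZ.
      have -> : t^-1 *: W + F = t^-1 *: X.
        by rewrite XE scalerDr scalerA mulVf ?gt_eqF // scale1r.
      by apply: pdZ => //; rewrite invr_gt0.
    rewrite -scalemxAr linearZ /= mulrC -mulNr ler_pdivrMr //; lra.
  + rewrite t0 mul0r addr0; apply: Ypos; split=> //.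
    by move: pX; rewrite {1}XE t0 scale0r addr0.
exists Z; split=> // X VX; rewrite ZY; last first.
  case: VX => Xs Xe; split=> // i j ij; rewrite /e' negb_or => /andP[nij _].
  exact: Xe.
by have := Y'E X 0 VX; rewrite scale0r mul0r !addr0.
Qed.

(** * Tangent functionals and their dimension *)

Section DualCone.
Variables (R : realType) (n : nat) (e : rel 'I_n).
Hypothesis e_sym : symmetric e.
Implicit Types (X Y : 'M[R]_n) (q phi : 'M[R]_n -> R) (u : 'cV[R]_n).
Local Notation V := (@sparse_matrices R n e).
Local Notation K := (sparse_spectrahedral_cone R e).

Definition lin_on q :=
  forall (a : R) X Y, V X -> V Y -> q (a *: X + Y) = a * q X + q Y.

Definition dual q := lin_on q /\ forall X, K X -> 0 <= q X.

(* For [q = quad^~ u] with connected support these are the derivatives at [u]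
   of [u |-> quad^~ u], i.e., the tangent vectors to the set of extreme rays of
   the dual cone. *)
Definition tangent q phi := lin_on phi /\ exists2 q2, dual q2 &
  forall (t : R) X, K X -> 0 <= q X + t * phi X + t ^+ 2 * q2 X.

(** Independence is witnessed by a biorthogonal system, which is easily transported by
    automorphisms. *)
Definition tangent_dim_ge q (k : nat) :=
  exists (phi : 'I_k -> 'M[R]_n -> R) (Xs : 'I_k -> 'M[R]_n),
    [/\ forall a, tangent q (phi a), forall b, V (Xs b)
      & forall a b, phi a (Xs b) = (a == b)%:R].

Lemma lin_onD q X Y : lin_on q -> V X -> V Y -> q (X + Y) = q X + q Y.
Proof. by move=> ql VX VY; rewrite -[X in LHS]scale1r ql // mul1r. Qed.

Lemma lin_on0 q : lin_on q -> q 0 = 0.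
Proof.
move=> ql; have := lin_onD ql (@sparse0 R n e) (@sparse0 R n e).
by rewrite addr0 => /eqP; rewrite -subr_eq0 opprD addrA subrr sub0r oppr_eq0 => /eqP.
Qed.

Lemma lin_onZ q (a : R) X : lin_on q -> V X -> q (a *: X) = a * q X.
Proof.
move=> ql VX; rewrite -[_ *: _]addr0 ql ?lin_on0 ?addr0 //.
exact: sparse0.
Qed.

Lemma lin_on_sum q (I : finType) (F : I -> 'M[R]_n) : lin_on q ->
  (forall i, V (F i)) -> q (\sum_i F i) = \sum_i q (F i).
Proof.
move=> ql VF.
suff [] : V (\sum_i F i) /\ q (\sum_i F i) = \sum_i q (F i) by [].
elim/big_rec2: _ => [|i y X _ [VX qX]].
  by split; [exact: sparse0 | rewrite lin_on0].
by split; [exact: sparseD | rewrite lin_onD // qX].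
Qed.

(** The values of [q] on symmetrised units fix the diagonal and edge entries; [dual_completion]
    supplies the others so that positivity extends to all positive semidefinite matrices. *)
Lemma dual_represent q : dual q -> exists Y, [/\ Y^T = Y,
  forall X, V X -> q X = \tr (Y *m X) & forall X, psd X -> 0 <= \tr (Y *m X)].
Proof.
move=> [ql qpos].
pose S i j : 'M[R]_n := if (i == j) || e i j then 2^-1 *: sym_delta R i j else 0.
have SC i j : S i j = S j i.
  by rewrite /S eq_sym e_sym /sym_delta addrC.
have VS i j : V (S i j).
  rewrite /S; case: ifP => [ij|_]; last exact: sparse0.
  by apply: sparseZ; apply: sparse_sym_delta.
have XE X : V X -> X = \sum_i \sum_j X i j *: S i j.
  move=> [Xs Xe]; have : X = 2^-1 *: (X + X^T).
    by rewrite [X^T]Xs -mulr2n -(scaler_nat 2 X) scalerA mulVf ?scale1r // pnatr_eq0.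
  rewrite {2 3}[X]matrix_sum_delta => {1}->.
  rewrite linear_sum /= -big_split scaler_sumr /=; apply: eq_bigr => i _.
  rewrite linear_sum /= -big_split scaler_sumr /=; apply: eq_bigr => j _.
  rewrite linearZ /= trmx_delta /S; case: ifP => [_|].
    by rewrite -scalerDr !scalerA mulrC.
  by move=> /norP[ij nij]; rewrite Xe // !scale0r addr0 !scaler0.
pose Y := \matrix_(i, j) q (S i j).
have Ys : Y^T = Y by apply/matrixP => i j; rewrite !mxE SC.
have qE X : V X -> q X = \tr (Y *m X).
  move=> VX; rewrite {1}(XE X VX) lin_on_sum //; last first.
    by move=> i; apply: sparse_sum => j; exact: sparseZ.
  rewrite mxtrace_mulE; apply: eq_bigr => i _.
  rewrite lin_on_sum; [|by []|by move=> j; exact: sparseZ].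
  apply: eq_bigr => j _.
  by rewrite lin_onZ // mxE mulrC; congr (_ * _); rewrite -[in LHS]VX.1 mxE.
have [|Z [Zs ZY Zp]] := dual_completion e_sym Ys.
  by move=> X KX; rewrite -qE; [exact: qpos | exact: cone_sparse].
by exists Z; split=> // X VX; rewrite ZY // qE.
Qed.

Lemma lin_on_quad u : lin_on (quad^~ u).
Proof. by move=> a X Y _ _; rewrite quadD quadZ. Qed.

Lemma dual_quad u : dual (quad^~ u).
Proof.
by split; [exact: lin_on_quad | move=> X /cone_pd/pd_psd[_]].
Qed.

Lemma mxtrace_rank1 Y u : \tr (Y *m (u *m u^T)) = quad Y u.
Proof. by rewrite mulmxA mxtrace_mulC mulmxA /quad /mxtrace big_ord1. Qed.

(* With [u = Y e_i], the functionals [X |-> (X u)_k] are tangent to [q] because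
   the congruence by [1 + t e_i e_k^T] preserves positive semidefiniteness. *)
Lemma tangent_dim_lower q Y (i : 'I_n) (S : {set 'I_n}) :
  Y^T = Y -> (forall X, V X -> q X = \tr (Y *m X)) ->
  (forall X, psd X -> 0 <= \tr (Y *m X)) ->
  (forall k, k \in S -> Y k i != 0 \/ exists2 l, e k l & Y l i != 0) ->
  tangent_dim_ge q #|S|.
Proof.
move=> Ys qE Ypos hS; pose phi k X := 2 * (X *m Y) k i.
have hd (a b l m : 'I_n) (M : 'M[R]_n) :
    (delta_mx a b *m M) l m = (l == a)%:R * M b m.
  rewrite mxE (bigD1 b) //= big1 => [|c /negbTE cb]; last by rewrite mxE cb andbF mul0r.
  by rewrite mxE eqxx andbT addr0.
have ent (c : R) (A B : 'M[R]_n) l m : (c *: (A + B)) l m = c * (A l m + B l m).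
  by rewrite !mxE.
have Yii : 0 <= Y i i.
  have := Ypos _ (psd_rank1 (1 *: delta_mx i ord0 + 0 *: delta_mx i ord0)).
  by rewrite mxtrace_rank1 quad_delta2 //; lra.
have tphi k : tangent q (phi k).
  split; first by move=> a X Z _ _; rewrite /phi mulmxDl -scalemxAl !mxE; ring.
  exists (fun X => Y i i * X k k).
    split; first by move=> a X Z _ _; rewrite !mxE; ring.
    move=> X /cone_pd/pd_psd[Xs Xp]; apply: mulr_ge0 => //.
    have := Xp (1 *: delta_mx k ord0 + 0 *: delta_mx k ord0).
    by rewrite quad_delta2 //; lra.
  move=> t X KX; have [Xs _] := cone_pd KX.
  (* The coefficients of this trace in powers of [t] are [q X], [phi k X] and [Y i i * X k k]. *)
  have := Ypos _ (psd_congr (1%:M + t *: delta_mx i k) (pd_psd (cone_pd KX))).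
  rewrite linearD /= linearZ /= trmx1 trmx_delta.
  rewrite mulmxDl mul1mx -scalemxAl mulmxDr mulmx1 -scalemxAr mulmxDl -scalemxAl.
  rewrite scalerDr scalerA !mulmxDr -!scalemxAr !linearD /= !linearZ /=.
  have -> : \tr (Y *m (delta_mx i k *m X)) = (X *m Y) k i.
    by rewrite mulmxA mxtrace_mulC mulmxA mxtrace_mulC mxtrace_delta.
  have -> : \tr (Y *m (X *m delta_mx k i)) = (X *m Y) k i.
    rewrite mulmxA mxtrace_mulC mxtrace_delta -[in LHS]Ys -[in LHS]Xs -trmx_mul.
    by rewrite mxE.
  have -> : \tr (Y *m (delta_mx i k *m X *m delta_mx k i)) = Y i i * X k k.
    rewrite mulmxA mxtrace_mulC mxtrace_delta mxE (bigD1 i) //= big1.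
      by rewrite hd eqxx mul1r addr0.
    by move=> l /negbTE li; rewrite hd li mul0r mulr0.
  rewrite -qE; last exact: cone_sparse.
  by move=> /le_trans; apply; rewrite le_eqVlt /phi; apply: predU1l; ring.
(* Dual vectors: a diagonal unit if [Y k i != 0], otherwise an edge unit with [Y l i != 0], whose
   unwanted term carries the factor [Y k i = 0]. *)
have /choice[W hW] : forall k, exists X, V X /\
    (k \in S -> forall l, phi l X = (l == k)%:R).
  move=> k; have [kS|nkS] := boolP (k \in S); last first.
    by exists 0; split=> //; exact: sparse0.
  have [Yk0|Yk] := eqVneq (Y k i) 0; last first.
    exists ((4 * Y k i)^-1 *: sym_delta R k k); split.
      by apply: sparseZ; apply: sparse_sym_delta => //; rewrite eqxx.
    move=> _ l; rewrite /phi -scalemxAl mulmxDl ent !hd; field.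
    by rewrite Yk.
  have [|[l kl Yl]] := hS k kS; first by rewrite Yk0 eqxx.
  exists ((2 * Y l i)^-1 *: sym_delta R k l); split.
    by apply: sparseZ; apply: sparse_sym_delta => //; rewrite kl orbT.
  move=> _ j; rewrite /phi -scalemxAl mulmxDl ent !hd Yk0; field.
  by rewrite Yl.
exists (fun a => phi (enum_val a)), (fun b => W (enum_val b)); split=> //.
  by move=> b; case: (hW (enum_val b)).
move=> a b; have [_ ->] := hW (enum_val b); last exact: enum_valP.
by rewrite (inj_eq enum_val_inj).
Qed.

(** Add to [X] a large multiple of the projection onto the complement of [u] and [d] times
    [u *m u^T]. At these points of the cone [quad^~ u] tends to [0] with [d], so the tangency
    inequality loses its constant term and its linear term must vanish. *)
Lemma tangent_quad_eq0 u phi X : u != 0 -> V (u *m u^T) ->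
  tangent (quad^~ u) phi -> V X -> X *m u = 0 -> phi X = 0.
Proof.
move=> u0 VU [pl [q2 [q2l q2p] h]] VX Xu.
set U := u *m u^T in VU; pose N := quad 1%:M u; have N0 : 0 < N by exact: quad1_gt0.
have Nn0 : N != 0 by rewrite gt_eqF.
have uu : u^T *m u = N%:M.
  by apply/matrixP => i j; rewrite !ord1 [RHS]mxE eqxx mulr1n /N /quad mulmx1.
(* [P] is [N] times the orthogonal projection onto the complement of [u]. *)
pose P := N *: 1%:M - U.
have VP : V P.
  rewrite /P; apply: sparse_lin; first exact: sparse1.
  by rewrite -scaleN1r; exact: sparseZ.
have Us : U^T = U by rewrite trmx_mul trmxK.
have Ps : P^T = P by rewrite /P linearB /= linearZ /= trmx1 Us.
have Pu : P *m u = 0.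
  by rewrite /P mulmxBl -scalemxAl mul1mx /U -mulmxA uu mul_mx_scalar subrr.
have UP : U *m P = 0.
  by rewrite -[U *m P]trmxK trmx_mul Us Ps /U mulmxA Pu mul0mx trmx0.
have PP : P *m P = N *: P by rewrite {1}/P mulmxBl UP subr0 -scalemxAl mul1mx.
have XU : X *m U = 0 by rewrite /U mulmxA Xu mul0mx.
have UX : U *m X = 0 by rewrite -[U *m X]trmxK trmx_mul Us [X^T]VX.1 XU trmx0.
have PXP : P *m X *m P^T = N ^+ 2 *: X.
  rewrite Ps /P mulmxBl UX subr0 mulmxBr -!scalemxAl !mul1mx -scalemxAr mulmx1.
  by rewrite XU scaler0 subr0 scalerA.
pose a := \sum_i \sum_j `|X i j|.
have a0 : 0 <= a by rewrite sumr_ge0 // => i _; rewrite sumr_ge0.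
have an0 : 0 <= a * n%:R by rewrite mulr_ge0.
(* [c *: P] dominates [X] on the complement of [u], and [d *: U] is positive along [u]; the [+ 1]
   leaves the margin [p / N]. *)
have Kz c d : a * n%:R / N + 1 <= c -> 0 < d -> K (d *: U + (c *: P + X)).
  move=> cN d0; have VZ : V (d *: U + (c *: P + X)).
    by apply: sparse_lin => //; exact: sparse_lin.
  split=> //; split; first exact: VZ.1.
  move=> v v0; rewrite -/(quad _ _) !quadD !quadZ.
  have qP : quad P v = quad 1%:M (P *m v) / N.
    by rewrite -[in RHS]Ps -quad_congr mulmx1 Ps PP quadZ mulrAC mulfV // mul1r.
  have qX : quad X v = quad X (P *m v) / N ^+ 2.
    by rewrite -[in RHS]Ps -quad_congr PXP quadZ mulrAC mulfV ?mul1r // expf_neq0.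
  have qU : quad U v = ((u^T *m v) ord0 ord0) ^+ 2 by exact: quad_rank1.
  have hb : - (a * n%:R * quad 1%:M (P *m v)) <= quad X (P *m v).
    by have := quad_bound (P *m v) (le_sum_entries X); rewrite ler_norml => /andP[].
  set p := quad 1%:M (P *m v) in qP hb.
  have p0 : 0 <= p by exact: quad1_ge0.
  have low : p / N <= c * quad P v + quad X v.
    rewrite qP qX; have : - (a * n%:R * p) / N ^+ 2 <= quad X (P *m v) / N ^+ 2.
      by rewrite ler_pM2r // invr_gt0 exprn_gt0.
    have : (a * n%:R / N + 1) * (p / N) <= c * (p / N).
      by rewrite ler_wpM2r // divr_ge0 // ltW.
    have -> : (a * n%:R / N + 1) * (p / N) = - (- (a * n%:R * p) / N ^+ 2) + p / N.
      by field.
    lra.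
  have [Pv0|Pv] := eqVneq (P *m v) 0; last first.
    have : 0 < p / N by rewrite divr_gt0 //; exact: quad1_gt0.
    by have := mulr_ge0 (ltW d0) (sqr_ge0 ((u^T *m v) ord0 ord0)); rewrite qU; lra.
  have w0 : (u^T *m v) ord0 ord0 != 0.
    apply: contra v0 => /eqP w0; rewrite -[v]scale1r -(mulVf Nn0) -scalerA.
    have : N *: v = P *m v + u *m (u^T *m v).
      by rewrite /P mulmxBl -scalemxAl mul1mx mulmxA subrK.
    rewrite Pv0 => ->; have -> : u^T *m v = 0.
      by apply/matrixP => i j; rewrite !ord1 w0 mxE.
    by rewrite mulmx0 addr0 scaler0.
  have : 0 < d * ((u^T *m v) ord0 ord0) ^+ 2.
    by rewrite mulr_gt0 // lt_def sqrf_eq0 w0 sqr_ge0.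
  by have := divr_ge0 p0 (ltW N0); rewrite qU; lra.
have phi0 c : a * n%:R / N + 1 <= c -> phi (c *: P + X) = 0.
  move=> hc; have Vz : V (c *: P + X) by exact: sparse_lin.
  apply: (@quadratic_ge0_lin _ _ (q2 (c *: P + X))) => t.
  apply: (@ge0_limit _ _ (N ^+ 2 + t * phi U + t ^+ 2 * q2 U)) => d d0.
  have := h t _ (Kz c d hc d0); rewrite pl // q2l // !quadD !quadZ.
  have -> : quad P u = 0 by rewrite /quad -mulmxA Pu mulmx0 mxE.
  have -> : quad X u = 0 by rewrite /quad -mulmxA Xu mulmx0 mxE.
  have -> : quad U u = N ^+ 2 by rewrite quad_rank1 uu mxE eqxx mulr1n.
  by move=> /le_trans; apply; rewrite le_eqVlt; apply: predU1l; ring.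
(* Two admissible values of [c] separate [phi P] from [phi X]. *)
clearbody P; set c := _ + 1 in phi0; have := phi0 _ (lexx c); have := phi0 (c + 1).
rewrite lerDl ler01 => /(_ isT); rewrite !pl // mulrDl mul1r.
move=> h1 h2; have {}h1 : phi P = 0 by rewrite addrAC h2 add0r in h1.
by rewrite h1 mulr0 add0r in h2.
Qed.

(** If [k] exceeded [#|S|], a nontrivial combination [X] of the dual vectors would satisfy
    [X *m u = 0]; tangent functionals vanish at it, yet they read off its coefficients. *)
Lemma tangent_dim_upper u (S : {set 'I_n}) k : u != 0 -> V (u *m u^T) ->
  (forall X j, V X -> j \notin S -> (X *m u) j ord0 = 0) ->
  tangent_dim_ge (quad^~ u) k -> (k <= #|S|)%N.
Proof.
move=> u0 VU hS [phi [Xs [tphi VXs hd]]]; rewrite leqNgt; apply/negP => Sk.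
pose M : 'M[R]_(k, #|S|) := \matrix_(b, j) (Xs b *m u) (enum_val j) ord0.
pose c := nz_row (kermx M).
have c0 : c != 0.
  rewrite nz_row_eq0 kermx_eq0 /row_free neq_ltn.
  by rewrite (leq_ltn_trans (rank_leq_col M) Sk).
have cM : c *m M = 0 by apply/sub_kermxP; exact: nz_row_sub.
pose X := \sum_b c ord0 b *: Xs b.
have VX : V X by apply: sparse_sum => b; exact: sparseZ.
have Xu : X *m u = 0.
  apply/matrixP => j l; rewrite ord1 [RHS]mxE.
  have [jS|nS] := boolP (j \in S); last exact: hS.
  have := congr1 (fun A : 'M[R]_(1, #|S|) => A ord0 (enum_rank_in jS j)) cM.
  rewrite [in RHS]mxE => <-; rewrite mulmx_suml summxE [RHS]mxE.
  apply: eq_bigr => b _; rewrite -scalemxAl [LHS]mxE; congr (_ * _).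
  by rewrite [RHS]mxE enum_rankK_in.
move/eqP: c0; apply; apply/matrixP => i a; rewrite ord1 [RHS]mxE.
have := tangent_quad_eq0 u0 VU (tphi a) VX Xu.
rewrite lin_on_sum; [|by case: (tphi a)|by move=> b; exact: sparseZ].
rewrite (bigD1 a) //= big1 => [|b /negbTE ba]; last first.
  by rewrite (lin_onZ _ (proj1 (tphi a)) (VXs b)) hd eq_sym ba mulr0.
by rewrite (lin_onZ _ (proj1 (tphi a)) (VXs a)) hd eqxx mulr1 addr0.
Qed.

End DualCone.

(** * An invariant of the automorphism group *)

Section Asymmetry.
Variables (R : realType) (n : nat) (e : rel 'I_n) (m : nat).
Implicit Types (X Y T : 'M[R]_n) (q phi : 'M[R]_n -> R) (f g : 'M[R]_n -> 'M[R]_n).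
Local Notation V := (@sparse_matrices R n e).
Local Notation K := (sparse_spectrahedral_cone R e).
Local Notation dual := (@dual R n e).
Local Notation tangent := (@tangent R n e).
Local Notation tangent_dim_ge := (@tangent_dim_ge R n e).

(** With [m] the dimension of a non-nested edge, the functionals of its two end points are among
    those that vanish here. *)
Definition null_below X :=
  V X /\ forall q, dual q -> (forall k, tangent_dim_ge q k -> (k < m)%N) -> q X = 0.

(* Up to functionals of dimension less than [m], both [q] and [- q] are positive:
   the non-nested edges of dimension [m] produce such [q]. *)
Definition balanced q := [/\ dual q, forall k, tangent_dim_ge q k -> (k <= m)%N
  & exists2 q', dual q' & forall X, null_below X -> q X + q' X = 0].

(* The convex set of those [T] with [X - T] nonnegative on balanced functionals
   contains [- l *: T] together with [T]. *)
Definition asymmetry_bound (l : R) X :=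
  forall T, null_below T -> (forall q, balanced q -> q T <= q X) ->
  forall q, balanced q -> 0 <= q X + l * q T.

Definition cone_endo f := [/\ forall (a : R) X Y, V X -> V Y ->
    f (a *: X + Y) = a *: f X + f Y, forall X, V X -> V (f X)
  & forall X, K X -> K (f X)].

Lemma lin_on_comp f q : cone_endo f -> lin_on e q -> lin_on e (q \o f).
Proof.
by move=> [fl fV _] ql a X Y VX VY; rewrite /= fl // ql //; exact: fV.
Qed.

Lemma dual_comp f q : cone_endo f -> dual q -> dual (q \o f).
Proof.
move=> fe [ql qp]; split; first exact: lin_on_comp.
by case: fe => _ _ fK X KX; exact/qp/fK.
Qed.

(** Agreement on the cone is all that is asked, because the two maps of a [cone_auto] are inverse to
    each other only on sparse matrices. *)
Lemma tangent_comp f q q' phi : cone_endo f ->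
  (forall X, K X -> q' X = q (f X)) -> tangent q phi -> tangent q' (phi \o f).
Proof.
move=> fe q'E [pl [q2 dq2 h]]; split; first exact: lin_on_comp.
exists (q2 \o f); first exact: dual_comp.
by move=> t X KX; rewrite q'E //; apply: h; case: fe => _ _; apply.
Qed.

Definition cone_auto f g := [/\ cone_endo f, cone_endo g,
  forall X, V X -> f (g X) = X & forall X, V X -> g (f X) = X].

Lemma cone_auto_sym f g : cone_auto f g -> cone_auto g f.
Proof. by case=> *; split. Qed.

Lemma tangent_dim_comp f g q k : cone_auto f g ->
  tangent_dim_ge (q \o f) k -> tangent_dim_ge q k.
Proof.
move=> [fe ge fg gf] [phi [Xs [tphi VXs hd]]].
exists (fun a => phi a \o g), (fun b => f (Xs b)); split.
- move=> a; apply: (tangent_comp ge _ (tphi a)) => X KX /=.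
  by rewrite fg //; exact: cone_sparse.
- by move=> b; case: fe => _ + _; apply.
- by move=> a b /=; rewrite gf.
Qed.

Lemma null_below_comp f g X : cone_auto f g -> null_below X -> null_below (f X).
Proof.
move=> a [VX h]; have [fe _ _ _] := a; split; first by case: fe => _ + _; apply.
move=> q dq lq; apply: (h (q \o f)); first exact: dual_comp.
by move=> k /(tangent_dim_comp a); exact: lq.
Qed.

Lemma balanced_comp f g q : cone_auto f g -> balanced q -> balanced (q \o f).
Proof.
move=> a [dq lq [q' dq' h]]; have [fe _ _ _] := a; split.
- exact: dual_comp.
- by move=> k /(tangent_dim_comp a); exact: lq.
- exists (q' \o f); first exact: dual_comp.
  by move=> X /(null_below_comp a); exact: h.
Qed.

Lemma asymmetry_bound_comp f g (l : R) X : cone_auto f g -> V X ->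
  asymmetry_bound l X -> asymmetry_bound l (f X).
Proof.
move=> a VX h T nT hT q bq; have [fe ge fg gf] := a.
have := h (g T) (null_below_comp (cone_auto_sym a) nT) _ _ (balanced_comp a bq).
rewrite /= fg; last by case: nT.
apply=> r br; have := hT _ (balanced_comp (cone_auto_sym a) br).
by rewrite /= gf.
Qed.

Lemma homogeneous_cone_auto X Y : homogeneous_convex_cone K -> K X -> K Y ->
  exists f g, cone_auto f g /\ f X = Y.
Proof.
move=> [_ _ _ /[apply]/[apply]]; rewrite linear_span_cone.
move=> [f [[fl [fV fi fs]] fK fXY]].
(* The inverse is chosen on all matrices; its values outside [V] are arbitrary. *)
have /choice[g hg] : forall Z, exists W, V Z -> V W /\ f W = Z.
  move=> Z; have [VZ|nZ] := pselect (V Z); last by exists 0.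
  by have [W VW <-] := fs _ VZ; exists W.
have gV Z : V Z -> V (g Z) by move=> /hg[].
have fg Z : V Z -> f (g Z) = Z by move=> /hg[].
have gf Z : V Z -> g (f Z) = Z.
  move=> VZ; apply: fi; rewrite ?inE //; first exact/gV/fV.
  by rewrite fg //; exact: fV.
exists f, g; split=> //; split=> //; split=> //.
- by move=> Z KZ; rewrite -fK; exists Z.
- move=> a Z W VZ VW; apply: fi; rewrite ?inE.
  + by apply: gV; exact: sparse_lin.
  + by apply: sparse_lin; exact: gV.
  + rewrite fg; last exact: sparse_lin.
    by rewrite fl ?fg //; exact: gV.
- move=> Z; rewrite -[X in X Z]fK => -[W KW <-]; rewrite gf //.
  exact: cone_sparse.
Qed.

End Asymmetry.

(** * Non-nested edges and the failure of homogeneity *)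

Section NonNestedEdge.
Variables (R : realType) (n : nat) (e : rel 'I_n).
Hypothesis e_sym : symmetric e.
Implicit Types (X Y T : 'M[R]_n) (q : 'M[R]_n -> R).
Local Notation V := (@sparse_matrices R n e).
Local Notation K := (sparse_spectrahedral_cone R e).
Local Notation N := (closed_nbhd e).

(** The case [i = j], [b = 0] is a basis vector, so vertices and edges are treated together. *)
Definition bivector (i j : 'I_n) (b : R) : 'cV[R]_n :=
  delta_mx i ord0 + b *: delta_mx j ord0.

Lemma quad_bivector X i j b : X^T = X ->
  quad X (bivector i j b) = X i i + b ^+ 2 * X j j + 2 * b * X i j.
Proof.
by move=> Xs; rewrite /bivector -[delta_mx i _]scale1r quad_delta2 //; ring.
Qed.

Lemma bivector_neq0 i j b : (i == j) ==> (b == 0) -> bivector i j b != 0.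
Proof.
move=> ij; apply/eqP => /matrixP /(_ i ord0); rewrite !mxE !eqxx !andbT.
have [eij|nij] := eqVneq i j; last by rewrite mulr0 addr0 => /eqP; rewrite oner_eq0.
by move: ij; rewrite eij eqxx => /eqP ->; rewrite mul0r addr0 => /eqP; rewrite oner_eq0.
Qed.

Lemma bivector_supp i j b k : bivector i j b k ord0 != 0 -> (k == i) || (k == j).
Proof.
apply: contraR; rewrite negb_or => /andP[/negbTE ki /negbTE kj].
by rewrite !mxE ki kj mulr0 addr0.
Qed.

(** For sparse [X], the product of [X] with the bivector is supported on [N i :|: N j]. *)
Lemma bivector_dim_le i j b k : (i == j) || e i j -> (i == j) ==> (b == 0) ->
  tangent_dim_ge e (quad^~ (bivector i j b)) k -> (k <= #|N i :|: N j|)%N.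
Proof.
move=> eij /bivector_neq0 u0; set u := bivector i j b in u0 *.
have us x y : u x ord0 != 0 -> u y ord0 != 0 -> (x == y) || e x y.
  move=> /bivector_supp/orP[]/eqP-> /bivector_supp/orP[]/eqP->; rewrite ?eqxx //.
  by rewrite eq_sym e_sym.
apply: tangent_dim_upper => //.
  split; first by rewrite /symmetric_matrices /= trmx_mul trmxK.
  move=> x y xy nxy; rewrite mxE big_ord1 [X in _ * X]mxE.
  apply/eqP; rewrite mulf_eq0; apply: contraNT nxy.
  by rewrite negb_or => /andP[ux uy]; have := us x y ux uy; rewrite (negbTE xy).
move=> X x [_ Xe] nx; rewrite mxE big1 // => y _; apply/eqP; rewrite mulf_eq0 orbC.
have [//|/bivector_supp uy] := boolP (u y ord0 == 0).
move: nx; rewrite !inE !negb_or => /andP[/andP[xi nxi] /andP[xj nxj]].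
by apply/eqP; apply: Xe; case/orP: uy => /eqP -> //; rewrite e_sym.
Qed.

Section Represented.
Variables (q : 'M[R]_n -> R) (Y : 'M[R]_n).
Hypotheses (Ys : Y^T = Y) (qE : forall X, V X -> q X = \tr (Y *m X))
  (Ypos : forall X, psd X -> 0 <= \tr (Y *m X)).

Lemma quad_represent_ge0 u : 0 <= quad Y u.
Proof. by rewrite -mxtrace_rank1; apply: Ypos; exact: psd_rank1. Qed.

Lemma represent_diag_ge0 i : 0 <= Y i i.
Proof.
by have := quad_represent_ge0 (bivector i i 0); rewrite quad_bivector //; lra.
Qed.

Lemma represent_diag_neq0 i j : Y i j != 0 -> Y i i != 0.
Proof.
apply: contra_neq => Yii.
(* When [Y i i = 0], the form at the bivector is twice [t * Y i j + t ^+ 2 * (Y j j / 2)]. *)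
apply: (@quadratic_ge0_lin _ _ (Y j j / 2)) => t.
have := quad_represent_ge0 (bivector i j t); rewrite quad_bivector // Yii; lra.
Qed.

(** Column [i] of [Y] is nonzero at both [i] and [j], so [tangent_dim_lower] reaches all their
    neighbours. *)
Lemma represent_dim_ge i j : Y i j != 0 -> tangent_dim_ge e q #|N i :|: N j|.
Proof.
move=> Yij; have Yji : Y j i != 0 by rewrite -Ys mxE.
have Yii := represent_diag_neq0 Yij.
apply: (tangent_dim_lower e_sym (i := i) Ys qE Ypos) => k; rewrite !inE.
move=> /orP[] /orP[/eqP -> |ek]; [by left | right | by left | right].
- by exists i => //; rewrite e_sym.
- by exists j => //; rewrite e_sym.
Qed.

End Represented.

Lemma null_below_diag m T i : null_below e m T -> (#|N i| < m)%N -> T i i = 0.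
Proof.
move=> [VT h] im; have := h _ (dual_quad e (bivector i i 0)).
rewrite quad_bivector ?expr0n /= ?mul0r ?mulr0 ?mul0r ?addr0; last exact: VT.1.
apply=> k /bivector_dim_le; rewrite !eqxx finset.setUid => /(_ isT isT) ki.
exact: leq_ltn_trans im.
Qed.

Lemma null_below_sym_delta m i j : (i == j) || e i j ->
  (m <= #|N i :|: N j|)%N -> null_below e m (sym_delta R i j).
Proof.
move=> eij mij; have VF := sparse_sym_delta R e_sym eij; split=> // q dq lq.
have [Y [Ys qE Ypos]] := dual_represent e_sym dq.
rewrite qE // mxtrace_mulC mxtrace_sym_delta //; apply/eqP; rewrite mulf_eq0.
have [_|/(represent_dim_ge Ys qE Ypos)/lq] := eqVneq (Y i j) 0.
  by rewrite orbT.
by rewrite ltnNge mij.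
Qed.

(** The partner uses [- b]: off-diagonal terms cancel in the sum, and the diagonal ones vanish by
    [null_below_diag]. *)
Lemma balanced_bivector m i j b : i != j -> e i j -> (#|N i :|: N j| <= m)%N ->
  (#|N i| < m)%N -> (#|N j| < m)%N -> balanced e m (quad^~ (bivector i j b)).
Proof.
move=> ij eij ijm im jm; split; first exact: dual_quad.
  move=> k /bivector_dim_le; rewrite eij (negbTE ij) => /(_ isT isT) ki.
  exact: leq_trans ijm.
exists (quad^~ (bivector i j (- b))); first exact: dual_quad.
move=> T nT; have [[Ts _] _] := nT; rewrite !quad_bivector //.
rewrite (null_below_diag nT im) (null_below_diag nT jm); ring.
Qed.

(** Where [Y] and [T] are both nonzero, the entry of [T] is at most [1] in absolute value and that
    of [Y] at most the mean of two diagonal entries. Summation bounds [|q T|] by [n] times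
    [q 1%:M]. *)
Lemma asymmetry_bound1 m : asymmetry_bound e m (n%:R + 1)^-1 (1%:M : 'M[R]_n).
Proof.
have aux (x y : R) : 0 <= x -> - (n%:R * x) <= y -> 0 <= x + (n%:R + 1)^-1 * y.
  move=> x0 xy; have n0 : 0 <= n%:R :> R by [].
  have np : 0 < n%:R + 1 :> R by lra.
  have : 0 <= (n%:R + 1) * (x + (n%:R + 1)^-1 * y).
    by rewrite mulrDr mulrA mulfV ?mul1r ?gt_eqF //; lra.
  by rewrite pmulr_rge0.
move=> T nT hT q bq; have [dq lq [q' dq' qq']] := bq.
have [Y [Ys qE Ypos]] := dual_represent e_sym dq.
have [Y' [Ys' qE' Ypos']] := dual_represent e_sym dq'.
have [VT _] := nT; have [Ts Te] := VT.
have Yge0 := represent_diag_ge0 Ys Ypos.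
(* If [m <= #|N i|], then [sym_delta R i i] is in [null_below]; there [q] and [q'] are nonnegative
   with sum zero. *)
have diag0 i : Y i i != 0 -> (#|N i| < m)%N.
  apply: contra_neqT; rewrite -leqNgt => mi.
  have ii : (i == i) || e i i by rewrite eqxx.
  have VF := sparse_sym_delta R e_sym ii.
  have := qq' _ (@null_below_sym_delta m i i ii _); rewrite finset.setUid => /(_ mi).
  rewrite qE // qE' // !(mxtrace_mulC _ (sym_delta _ _ _)) !mxtrace_sym_delta //.
  have := Yge0 i; have := represent_diag_ge0 Ys' Ypos' i; lra.
have bnd i j : `|Y i j * T j i| <= (Y i i + Y j j) / 2.
  have Yp : 0 <= (Y i i + Y j j) / 2 by rewrite divr_ge0 ?addr_ge0.
  have [->|Yij] := eqVneq (Y i j) 0; first by rewrite mul0r normr0.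
  have Yji : Y j i != 0 by rewrite -Ys mxE.
  have im := diag0 _ (represent_diag_neq0 Ys Ypos Yij).
  have jm := diag0 _ (represent_diag_neq0 Ys Ypos Yji).
  have [->|ij] := eqVneq i j.
    by rewrite (null_below_diag nT jm) mulr0 normr0 divr_ge0 ?addr_ge0.
  have Tji : T j i = T i j by rewrite -[in LHS]Ts mxE.
  rewrite Tji; have [eij|nij] := boolP (e i j); last by rewrite Te // mulr0 normr0.
  have ijm := lq _ (represent_dim_ge Ys qE Ypos Yij).
  (* Testing with [b = 1] and [b = -1] gives [2 T_ij <= 2] and [- 2 T_ij <= 2]. *)
  have hb b := hT _ (balanced_bivector b ij eij ijm im jm).
  have T1 : `|T i j| <= 1.
    have := hb 1; have := hb (-1); rewrite !quad_bivector ?trmx1 //.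
    rewrite (null_below_diag nT im) (null_below_diag nT jm) !mxE.
    rewrite !eqxx (negbTE ij) ?mulr1n ?mulr0n.
    by rewrite ler_norml => ? ?; apply/andP; split; lra.
  have Y1 : `|Y i j| <= (Y i i + Y j j) / 2.
    have := quad_represent_ge0 Ypos (bivector i j 1).
    have := quad_represent_ge0 Ypos (bivector i j (-1)); rewrite !quad_bivector //.
    by rewrite ler_norml => ? ?; apply/andP; split; lra.
  by rewrite normrM -[leRHS]mulr1; apply: ler_pM.
have q1 : q 1%:M = \sum_i Y i i by rewrite qE ?mulmx1 //; exact: sparse1.
have q10 : 0 <= q 1%:M by rewrite q1 sumr_ge0.
have : `|q T| <= n%:R * q 1%:M.
  rewrite qE // mxtrace_mulE; apply: (le_trans (ler_norm_sum _ _ _)).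
  have -> : n%:R * q 1%:M = \sum_i \sum_j (Y i i + Y j j) / 2.
    under eq_bigr => i _ do rewrite -mulr_suml big_split /=.
    rewrite -mulr_suml big_split /= exchange_big /= !sumr_const card_ord q1.
    by rewrite -[_ *+ n]mulr_natl; field.
  apply: ler_sum => i _; apply: (le_trans (ler_norm_sum _ _ _)).
  by apply: ler_sum => j _; exact: bnd.
by rewrite ler_norml => /andP[h _]; exact: aux.
Qed.

(** Homogeneity carries the bound at [1%:M] to [1%:M + (1 - l) *: F], where the functional of
    [e_i - e_j] violates it. *)
Lemma homogeneous_cone_nested i j : homogeneous_convex_cone K -> i != j -> e i j ->
  (N i \subset N j) || (N j \subset N i).
Proof.
move=> hK ij eij; apply: contraT => /norP[nij nji]; suff : False by [].
pose m := #|N i :|: N j|.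
have im : (#|N i| < m)%N.
  apply: proper_card; rewrite properUl //.
have jm : (#|N j| < m)%N.
  by rewrite /m finset.setUC; apply: proper_card; rewrite properUl.
pose l : R := (n%:R + 1)^-1.
have n0 : (0 < n)%N by exact: leq_ltn_trans (ltn_ord i).
have l0 : 0 < l by rewrite invr_gt0 ltr_wpDl.
have l1 : l < 1 by rewrite invf_lt1; [rewrite ltrDr ltr0n | rewrite ltr_wpDl].
pose F := sym_delta R i j; have eij' : (i == j) || e i j by rewrite eij orbT.
have VF : V F by exact: sparse_sym_delta.
have qF v : quad F v = 2 * (v i ord0 * v j ord0).
  rewrite -mxtrace_rank1 mxtrace_sym_delta ?trmx_mul ?trmxK //.
  by rewrite !mxE big_ord1 !mxE.
have pF (s : R) : s ^+ 2 = 1 -> psd (1%:M + s *: F).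
  move=> s1; split; first by rewrite linearD /= linearZ /= trmx1 tr_sym_delta.
  move=> v; rewrite quadD quadZ qF quad1E (bigD1 i) //= (bigD1 j) /=; last first.
    by rewrite eq_sym.
  set r := \sum_(k | _) _; have r0 : 0 <= r.
    by rewrite sumr_ge0 // => k _; exact: sqr_ge0.
  have -> : v i ord0 ^+ 2 + (v j ord0 ^+ 2 + r) + s * (2 * (v i ord0 * v j ord0)) =
      (v i ord0 + s * v j ord0) ^+ 2 + (1 - s ^+ 2) * v j ord0 ^+ 2 + r by ring.
  by rewrite s1 subrr mul0r addr0 addr_ge0 // sqr_ge0.
have pF1 : psd (1%:M + F) by rewrite -[F]scale1r; apply: pF; rewrite expr1n.
have pFN1 : psd (1%:M - F) by rewrite -scaleN1r; apply: pF; rewrite sqrrN expr1n.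
have KX : K (1%:M + (1 - l) *: F).
  have -> : 1%:M + (1 - l) *: F = l *: 1%:M + (1 - l) *: (1%:M + F).
    by rewrite (scalerDr _ 1%:M F) addrA -scalerDl [l + _]addrC subrK scale1r.
  apply: coneD; first exact: coneZ l0 (@cone1 R n e).
    by apply: sparseZ; apply: sparseD => //; exact: sparse1.
  by apply: psdZ => //; rewrite subr_ge0 ltW.
have [f [g [fg fX]]] := homogeneous_cone_auto hK (@cone1 R n e) KX.
have := asymmetry_bound_comp fg (@sparse1 R n e) (@asymmetry_bound1 m); rewrite fX.
(* This multiple of [F] differs from the chosen point by [1%:M - F], which is positive
   semidefinite. *)
have nF : null_below e m ((2 - l) *: F).
  have [_ nF] := null_below_sym_delta eij' (leqnn m).
  split; first exact: sparseZ.
  by move=> q dq lq; rewrite (lin_onZ _ dq.1 VF) nF // mulr0.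
move=> /(_ _ nF) h.
have /h : forall q, balanced e m q -> q ((2 - l) *: F) <= q (1%:M + (1 - l) *: F).
  move=> q [dq _ _]; have [Y [_ qE Ypos]] := dual_represent e_sym dq.
  rewrite -subr_ge0 !qE; [|exact: sparseZ|exact: cone_sparse KX].
  rewrite -linearB /= -mulmxBr -addrA -scalerBl.
  have -> : 1 - l - (2 - l) = -1 by ring.
  by rewrite scaleN1r; exact: Ypos.
(* The functional is [2 l] at the point and [- 2 (2 - l)] at the multiple of [F], so the bound would
   read [0 <= - 2 l (1 - l)]. *)
move=> /(_ _ (balanced_bivector (-1) ij eij (leqnn _) im jm)).
rewrite quadD !quadZ !quad_bivector ?trmx1 ?tr_sym_delta //.
rewrite !mxE !eqxx (negbTE ij) [j == i]eq_sym (negbTE ij) ?mulr1n ?mulr0n /= => hl.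
have ll : 0 < l * (1 - l) by rewrite mulr_gt0 ?subr_gt0.
by move: hl ll; rewrite -/l; clear; lra.
Qed.

End NonNestedEdge.

Theorem theorem5p6 (R : realType) (n : nat) (e : rel 'I_n)
    (e_sym : symmetric e) (e_irr : irreflexive e) :
  homogeneous_convex_cone (sparse_spectrahedral_cone R e) <->
  homogeneous_chordal e.
Proof.
split=> [hK|]; last exact: chordal_cone_homogeneous.
apply: nested_homogeneous_chordal => // i j eij.
apply: (homogeneous_cone_nested e_sym hK) => //.
by apply: contraTneq eij => ->; rewrite e_irr.
Qed.
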